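(* Assume $x(0)=0$ and $x'(0)=0$. If $x(t)\to0$ and $x'(t)\to0$ as $t\to\infty$, then $y_1(t)\to0$ as $t\to\infty$.
   Context: Standing assumptions: $\omega>0$ is a constant; $p\in C^1([0,\infty))$ with $p(t)>0$ and $p'(t)<0$ for all $t\ge0$, $\int_0^\infty p(t)\,dt=\infty$ and $\int_0^\infty p(t)^2\,dt<\infty$; $f\in L^1_{\mathrm{loc}}([0,\infty))$. $x$ denotes the solution of $x''(t)+p(t)x'(t)+\omega^2x(t)=f(t)$, $t\ge0$. $y_1(t)=\int_0^te^{-\omega^2(t-s)}f(s)\,ds$, i.e. the solution of $y_1'=-\omega^2y_1+f$, $y_1(0)=0$. *)

(* Defs.v *)
From HB Require Import structures.
From mathcomp Require Import all_boot all_order all_algebra.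
From mathcomp Require Import all_classical all_reals all_analysis.
Set Implicit Arguments. Unset Strict Implicit. Unset Printing Implicit Defensive.
Import Order.TTheory GRing.Theory Num.Theory.
Import numFieldNormedType.Exports.
Local Open Scope classical_set_scope.
Local Open Scope ring_scope.

Definition y1 {R : realType} (w : R) (f : R -> R) (t : R) : R :=
  Rintegral (@lebesgue_measure R) `[0, t]
    (fun s => expR (- (w ^+ 2) * (t - s)) * f s).

Definition loc_integrable0 {R : realType} (f : R -> R) : Prop :=
  forall T : R, 0 <= T -> (@lebesgue_measure R).-integrable `[0, T] (EFin \o f).

(* (x, x1) is a (Caratheodory) solution on [0,oo) of
   x'' + p x' + w^2 x = f, written in integrated form:
   x, x1 continuous on [0,oo), x(t) = x(0) + int_0^t x1, and
   x1(t) = x1(0) + int_0^t (f - p x1 - w^2 x). Thus x is C^1 with x' = x1,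
   and x' is absolutely continuous with x'' = f - p x' - w^2 x a.e. *)
Definition is_solution {R : realType} (w : R) (p f x x1 : R -> R) : Prop :=
  [/\ {within `[0, +oo[, continuous x},
      {within `[0, +oo[, continuous x1},
      (forall t : R, 0 <= t ->
         x t = x 0 + Rintegral (@lebesgue_measure R) `[0, t] x1) &
      (forall t : R, 0 <= t ->
         x1 t = x1 0 + Rintegral (@lebesgue_measure R) `[0, t]
                  (fun s => f s - p s * x1 s - w ^+ 2 * x s))].

(* Main.v *)
Require Import Defs.
From HB Require Import structures.
From mathcomp Require Import all_boot all_order all_algebra.
From mathcomp Require Import all_classical all_reals all_analysis.
From mathcomp Require Import measurable_realfun ring.
Import Order.TTheory GRing.Theory Num.Theory.
Import numFieldNormedType.Exports.
Local Open Scope classical_set_scope.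
Local Open Scope ring_scope.

(** With a := w^2 the equation reads f = x1' + p x1 + a x.  Integrating by parts
    the term x1' against the kernel exp(-a(t-s)) gives
      y1(t) = x1(t) + \int_0^t exp(-a(t-s)) (p x1 + a x - a x1)(s) ds.
    As p is decreasing and positive, hence bounded, the bracket tends to 0, and
    convolution with an integrable exponential preserves convergence to 0.
    Since x1 is only absolutely continuous, the integration by parts is Fubini's
    theorem on the triangle 0 <= s <= r <= t. *)

(** * Integrability of products and exchange of the order of integration *)

Lemma integrable_continuousM (R : realType) (a b : R) (phi f : R -> R) :
  {within `[a, b], continuous phi} ->
  (@lebesgue_measure R).-integrable `[a, b] (EFin \o f) ->
  (@lebesgue_measure R).-integrable `[a, b] (EFin \o (fun s => phi s * f s)).
Proof.
move=> cphi intf.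
rewrite (_ : _ \o _ = ((EFin \o phi) \* (EFin \o f))%E) //.
apply: integrableMr => //.
  by apply: subspace_continuous_measurable_fun.
have /compact_bounded[M [_ mrt]] := continuous_compact cphi (@segment_compact _ a b).
by exists M; split; rewrite ?num_real // => ? ? ? ?; exact: mrt.
Qed.

(** Both sides integrate [h s * g r] over the triangle [a <= s <= r <= b], and Fubini's theorem
    exchanges the order. Only integrability of [g] and [h] is assumed, so this serves as integration
    by parts for absolutely continuous primitives. *)
Lemma Rintegral_triangle (R : realType) (a b : R) (g h : R -> R) :
  (@lebesgue_measure R).-integrable `[a, b] (EFin \o g) ->
  (@lebesgue_measure R).-integrable `[a, b] (EFin \o h) ->
  Rintegral (@lebesgue_measure R) `[a, b]
    (fun s => h s * Rintegral (@lebesgue_measure R) `[s, b] g) =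
  Rintegral (@lebesgue_measure R) `[a, b]
    (fun r => g r * Rintegral (@lebesgue_measure R) `[a, r] h).
Proof.
move=> ig ih; set mu := @lebesgue_measure R.
pose T : measurableType _ := measurableTypeR R.
have mkc f : mu.-integrable `[a, b] (EFin \o f) ->
    mu.-integrable setT (EFin \o (f \_ `[a, b])).
  move=> intf; rewrite -restrict_EFin.
  by have [|+ _] := @integrable_mkcond _ _ _ mu `[a, b]%classic (EFin \o f); last exact.
(* Extension by zero moves the problem to the whole plane; the indicator of the half-plane [D] then
   cuts out the triangle. *)
pose G : T -> R := g \_ `[a, b]; pose H : T -> R := h \_ `[a, b].
have iG : mu.-integrable setT (EFin \o G) by exact: mkc.
have iH : mu.-integrable setT (EFin \o H) by exact: mkc.
have mG : measurable_fun setT G by apply/measurable_EFinP; exact: measurable_int iG.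
have mH : measurable_fun setT H by apply/measurable_EFinP; exact: measurable_int iH.
have mnorm (F : T -> R) : measurable_fun setT F ->
    measurable_fun setT (fun r => `|F r|%:E).
  by move=> mF; apply/measurable_EFinP; exact: measurableT_comp.
have mnG := mnorm _ mG; have mnH := mnorm _ mH.
pose D := [set z : T * T | (z.1 : R) <= z.2].
have mD : measurable D.
  rewrite (_ : D = (fun z : T * T => (z.1 : R) <= z.2) @^-1` [set true]) //.
  rewrite -[X in measurable X]setTI.
  by apply: measurable_fun_ler;
    [exact: (@measurable_fst _ _ T T)|exact: (@measurable_snd _ _ T T)|..].
pose k (z : T * T) : R := H z.1 * G z.2 * \1_D z.
have mk : measurable_fun setT (EFin \o k).
  apply/measurable_EFinP; apply: measurable_funM; last exact: measurable_indic.
  by apply: measurable_funM; [exact: (measurableT_comp mH)|exact: (measurableT_comp mG)].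
have ik : (mu \x mu)%E.-integrable setT (EFin \o k).
  (* Tonelli's criterion: [k] is dominated by the product of [|H|] and [|G|], so the iterated
     integral of its absolute value is at most the integral of [|H|] times [C]. *)
  apply: (@integrable12ltyP _ _ T T R mu mu (EFin \o k) mk).2.
  pose C := (\int[mu]_y `|(G y)%:E|)%E.
  have Cfin : C \is a fin_num.
    by apply/integrable_fin_num; [|exact: integrable_abse iG].
  apply: (@le_lt_trans _ _ (\int[mu]_x (`|(H x)%:E| * C))%E).
    apply: ge0_le_integral => //=.
    - by move=> s _; exact: integral_ge0.
    - apply: (measurable_fun_fubini_tonelli_F (abse \o (EFin \o k))) => //=.
      exact: measurableT_comp.
    - exact: emeasurable_funM.
    move=> s _; rewrite -ge0_integralZl//=.
    apply: ge0_le_integral => //=.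
    - by apply/measurable_EFinP; apply: measurableT_comp => //;
        apply/measurable_EFinP; exact: (measurableT_comp mk).
    - exact: measurable_funeM.
    move=> r _; rewrite -EFinM lee_fin /k/= !normrM.
    by rewrite ler_piMr// /indic; case: (_ \in _); rewrite ?normr1 ?normr0.
  rewrite -(fineK Cfin); apply: integrable_lty => //.
  exact: (integrableZr measurableT (fine C) (integrable_abse iH)).
have memI (c d z : R) : (z \in `[c, d]%classic) = (c <= z <= d).
  by apply/idP/idP; rewrite inE /= in_itv.
have kE s r : k (s, r) =
    if (a <= s <= b) && (a <= r <= b) && (s <= r) then h s * g r else 0.
  rewrite /k /H /G /patch /= !memI /indic.
  have -> : ((s, r) \in D) = (s <= r) by apply/idP/idP; rewrite inE.
  by case: (a <= s <= b); case: (a <= r <= b); case: (s <= r);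
    rewrite ?mulr1 ?mulr0 ?mul0r.
have := Fubini ik.
set L := (X in X = _ -> _); set S := (X in _ = X -> _).
have -> : L = (\int[mu]_(s in `[a, b]) (h s * Rintegral mu `[s, b] g)%:E)%E.
  rewrite [RHS]integral_mkcond; apply: eq_integral => s _.
  rewrite /patch memI; case: ifPn => [/andP[as_ sb]|sab]; last first.
    by rewrite integral0_eq// => r _; rewrite /= kE (negbTE sab).
  have ig' : mu.-integrable `[s, b] (EFin \o g).
    by apply: integrableS ig => //; apply: subset_itvr; rewrite bnd_simp.
  transitivity (\int[mu]_(r in `[s, b]) (h s * g r)%:E)%E.
    rewrite [RHS]integral_mkcond; apply: eq_integral => r _.
    rewrite /= kE /patch memI as_ sb /=.
    by case: (leP s r) => [sr|_]; rewrite ?andbF// (le_trans as_ sr) /= andbT; case: ifP.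
  under eq_integral do rewrite EFinM.
  rewrite integralZl//; rewrite EFinM /Rintegral fineK//.
  exact: integrable_fin_num.
have -> : S = (\int[mu]_(r in `[a, b]) (g r * Rintegral mu `[a, r] h)%:E)%E.
  rewrite [RHS]integral_mkcond; apply: eq_integral => r _.
  rewrite /patch memI; case: ifPn => [/andP[ar rb]|rab]; last first.
    by rewrite integral0_eq// => s _; rewrite /= kE (negbTE rab) andbF.
  have ih' : mu.-integrable `[a, r] (EFin \o h).
    by apply: integrableS ih => //; apply: subset_itvl; rewrite bnd_simp.
  transitivity (\int[mu]_(s in `[a, r]) (g r * h s)%:E)%E.
    rewrite [RHS]integral_mkcond; apply: eq_integral => s _.
    rewrite /= kE /patch memI ar rb /= andbT mulrC.
    by case: (leP s r) => [sr|_]; rewrite ?andbF// (le_trans sr rb) !andbT; case: ifP.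
  under eq_integral do rewrite EFinM.
  rewrite integralZl//; rewrite EFinM /Rintegral fineK//.
  exact: integrable_fin_num.
by rewrite /Rintegral => ->.
Qed.

(** * The exponential kernel: primitive, integration by parts, convolution *)

Lemma continuous_exp_kernel (R : realType) (a t : R) :
  continuous (fun r => expR (- a * (t - r))).
Proof.
move=> r; apply: (@continuous_comp _ _ _ (fun r => - a * (t - r)) expR).
  apply: cvgM; first exact: cvg_cst.
  by apply: cvgB; [exact: cvg_cst|exact: cvg_id].
exact: continuous_expR.
Qed.

Lemma integrable_exp_kernelM (R : realType) (a t b c : R) (f : R -> R) :
  (@lebesgue_measure R).-integrable `[b, c] (EFin \o f) ->
  (@lebesgue_measure R).-integrable `[b, c]
    (EFin \o (fun s => expR (- a * (t - s)) * f s)).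
Proof.
apply: integrable_continuousM; apply: continuous_subspaceT.
exact: continuous_exp_kernel.
Qed.

Lemma integrable_exp_kernel (R : realType) (a t b c : R) :
  (@lebesgue_measure R).-integrable `[b, c]
    (EFin \o (fun r => a * expR (- a * (t - r)))).
Proof.
apply: integrable_continuousM; first exact/continuous_subspaceT/cst_continuous.
apply: continuous_compact_integrable; first exact: segment_compact.
exact/continuous_subspaceT/continuous_exp_kernel.
Qed.

Lemma Rintegral_exp_kernel (R : realType) (a s t : R) : s <= t ->
  Rintegral (@lebesgue_measure R) `[s, t] (fun r => a * expR (- a * (t - r))) =
  1 - expR (- a * (t - s)).
Proof.
rewrite le_eqVlt => /predU1P[->|st].
  (* The fundamental theorem of calculus needs a nondegenerate interval; for [s = t] both sides
     vanish. *)
  by rewrite set_itv1 Rintegral_set1 subrr mulr0 expR0 subrr.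
pose F r := expR (- a * (t - r)).
have dF (r : R) : is_derive r 1 F (a * expR (- a * (t - r))).
  have dL : is_derive r 1 (- a \*: (cst t - id)) a.
    by apply: is_derive_eq; rewrite sub0r [_ *: _]mulrN1 opprK.
  rewrite mulrC; exact: (is_derive1_comp (is_derive_expR _) dL).
have cF : continuous F := continuous_exp_kernel R a t.
rewrite /Rintegral (continuous_FTC2 (F := F) st).
- by rewrite /= /F subrr mulr0 expR0.
- apply: continuous_subspaceT => r; apply: cvgM; first exact: cvg_cst.
  exact: continuous_exp_kernel.
- split.
  + by move=> r _; exact: ex_derive.
  + exact/cvg_at_right_filter/cF.
  + exact/cvg_at_left_filter/cF.
- by move=> r _; rewrite derive1E; exact: derive_val.
Qed.

(** By the triangle exchange, the double integral becomes that of [h s] times the mass of the kernel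
    on [[s, t]], which is [1 - expR (- a * (t - s))]. *)
Lemma Rintegral_exp_kernel_by_parts (R : realType) (a t : R) (h : R -> R) :
  (@lebesgue_measure R).-integrable `[0, t] (EFin \o h) ->
  Rintegral (@lebesgue_measure R) `[0, t] (fun s => expR (- a * (t - s)) * h s) =
  Rintegral (@lebesgue_measure R) `[0, t] h -
  Rintegral (@lebesgue_measure R) `[0, t] (fun r => a * expR (- a * (t - r)) *
    Rintegral (@lebesgue_measure R) `[0, r] h).
Proof.
move=> ih; rewrite -Rintegral_triangle//; last exact: integrable_exp_kernel.
have ihe := integrable_exp_kernelM _ a t _ _ _ ih.
rewrite [X in _ - X](_ : _ = Rintegral (@lebesgue_measure R) `[0, t]
    (fun s => h s - expR (- a * (t - s)) * h s)).
  by rewrite RintegralB//; ring.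
apply: eq_Rintegral => s; rewrite inE /= in_itv /= => /andP[_ st].
by rewrite Rintegral_exp_kernel//; ring.
Qed.

(** The integral is split at a time [T] after which [g] is small. The part before [T] is a constant
    times a decaying exponential; the part after it is small because [a * expR (- a * (t - s))] has
    mass at most 1. *)
Lemma cvg_exp_convolution0 (R : realType) (a : R) (g : R -> R) : 0 < a ->
  loc_integrable0 g -> g t @[t --> +oo] --> 0 ->
  Rintegral (@lebesgue_measure R) `[0, t] (fun s => expR (- a * (t - s)) * g s)
    @[t --> +oo] --> 0.
Proof.
move=> a0 ig g0; apply/cvgr0Pnorm_le => e e0.
have e2 : 0 < e / 2 by rewrite divr_gt0.
(* The bound is [e / 2 * a] rather than [e / 2]: the factor [a] normalizes the kernel in the tail
   estimate. *)
have [M [_ gM]] := cvgr0_norm_le _ g0 _ (mulr_gt0 e2 a0).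
(* [M] may be negative and [gM] holds only strictly beyond it; this [T] is nonnegative and exceeds
   [M]. *)
pose T := `|M| + 1.
have MT : M < T by rewrite /T (le_lt_trans (ler_norm M))// ltrDl.
have T0 : 0 <= T by rewrite /T addr_ge0.
pose C := Rintegral (@lebesgue_measure R) `[0, T]
  (fun s => expR (- a * (T - s)) * g s).
have decay : expR (- a * (t - T)) * C @[t --> +oo] --> 0.
  rewrite -[0](mul0r C); apply: cvgMl.
  under eq_fun do rewrite mulNr.
  apply: (@cvg_comp _ _ _ (fun t => a * (t - T)) (fun u => expR (- u)) _ +oo);
    last exact: cvgr_expR.
  apply: gt0_cvgMry => //; apply/cvgryPge => A; near=> u.
  by rewrite lerBrDr; near: u; apply: nbhs_pinfty_ge; rewrite num_real.
near=> t.
have Tt : T <= t by near: t; apply: nbhs_pinfty_ge; rewrite num_real.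
have it : (@lebesgue_measure R).-integrable `[0, t]
    (EFin \o (fun s => expR (- a * (t - s)) * g s)).
  by apply: integrable_exp_kernelM; apply: ig; exact: le_trans Tt.
have iTt : (@lebesgue_measure R).-integrable `[T, t]
    (EFin \o (fun s => expR (- a * (t - s)) * g s)).
  by apply: integrableS it => //; apply: subset_itvr; rewrite bnd_simp.
rewrite -[X in `|X|](subrKC (Rintegral (@lebesgue_measure R) `[0, T]
  (fun s => expR (- a * (t - s)) * g s))).
rewrite Rintegral_itvB ?bnd_simp//.
rewrite Rintegral_itv_obnd_cbnd; last first.
  by apply: integrableS iTt => //; apply: subset_itvr; rewrite bnd_simp.
rewrite [e]splitr (le_trans (ler_normD _ _))// lerD//; last first.
  apply: le_trans (le_normr_Rintegral _ _) _ => //.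
  apply: (@le_trans _ _ (Rintegral (@lebesgue_measure R) `[T, t]
     (fun s => e / 2 * (a * expR (- a * (t - s)))))).
    apply: le_Rintegral => //.
    - by apply: integrable_norm; exact: iTt.
    - apply: integrable_continuousM; first exact/continuous_subspaceT/cst_continuous.
      exact: integrable_exp_kernel.
    move=> s /=; rewrite in_itv/= => /andP[Ts _].
    rewrite normrM ger0_norm ?expR_ge0// mulrA mulrC ler_wpM2r ?expR_ge0//.
    exact: gM (lt_le_trans MT Ts).
  rewrite RintegralZl//; last exact: integrable_exp_kernel.
  rewrite Rintegral_exp_kernel// ler_piMr ?(ltW e2)// gerBl expR_ge0.
(* Since [t - s = (t - T) + (T - s)], the dependence on [t] factors out of the integral over
   [[0, T]]. *)
rewrite [X in `|X|](_ : _ = expR (- a * (t - T)) * C).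
  by near: t; exact: cvgr0_norm_le _ decay _ e2.
rewrite -RintegralZl//; last exact/integrable_exp_kernelM/ig.
apply: eq_Rintegral => s _; rewrite mulrA -expRD; congr (expR _ * _); ring.
Unshelve. all: by end_near.
Qed.

(** * Application to the oscillator equation *)

Theorem mainTheorem4 (R : realType) (w : R) (p f x x1 : R -> R)
  (hw : 0 < w)
  (hpd : forall t : R, 0 <= t -> derivable p t 1)
  (hpc : {within `[0, +oo[, continuous (derive1 p)})
  (hpos : forall t : R, 0 <= t -> 0 < p t)
  (hdneg : forall t : R, 0 <= t -> (derive1 p) t < 0)
  (hpint : (\int[@lebesgue_measure R]_(t in `[0%R, +oo[%classic) (p t)%:E = +oo)%E)
  (hp2 : (\int[@lebesgue_measure R]_(t in `[0%R, +oo[%classic) ((p t) ^+ 2)%:E < +oo)%E)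
  (hf : loc_integrable0 f)
  (hsol : is_solution w p f x x1)
  (hx0 : x 0 = 0) (hx10 : x1 0 = 0)
  (hxlim : x t @[t --> +oo] --> 0)
  (hx1lim : x1 t @[t --> +oo] --> 0) :
  y1 w f t @[t --> +oo] --> 0.
Proof.
case: hsol => cx cx1 _ x1E.
set a := w ^+ 2 in x1E *; have a0 : 0 < a by rewrite exprn_gt0.
have cp T : {within `[0, T], continuous p}.
  apply: derivable_within_continuous => t; rewrite in_itv/= => /andP[t0 _].
  exact: hpd.
have ctsS (T : R) (u : R -> R) : {within `[0, +oo[, continuous u} ->
    {within `[0, T], continuous u}.
  by apply: continuous_subspaceW => t /=; rewrite !in_itv/= => /andP[->].
have ple t : 0 <= t -> p t <= p 0.
  move=> t0; apply: (@ler0_derive1_le_cc _ p 0 t) => //.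
  - by move=> s; rewrite in_itv/= => /andP[s0 _]; apply/hpd/ltW.
  - by move=> s; rewrite in_itv/= => /andP[s0 _]; apply/ltW/hdneg/ltW.
  - by rewrite in_itv/= lexx ?t0.
  - by rewrite in_itv/= lexx ?t0.
have ix1 : loc_integrable0 x1.
  move=> T _; apply: continuous_compact_integrable; last exact: ctsS.
  exact: segment_compact.
have ix : loc_integrable0 x.
  move=> T _; apply: continuous_compact_integrable; last exact: ctsS.
  exact: segment_compact.
pose g s := p s * x1 s + a * x s.
have ig : loc_integrable0 g.
  move=> T T0; rewrite (_ : _ \o _ =
    (EFin \o (fun s => p s * x1 s)%R) \+ (EFin \o (fun s => a * x s)%R))%E//.
  apply: integrableD => //.
  - exact: (integrable_continuousM _ _ _ _ _ (cp T) (ix1 T T0)).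
  - apply: (integrable_continuousM _ _ _ _ _ _ (ix T T0)).
    exact/continuous_subspaceT/cst_continuous.
(* [h] represents x'' almost everywhere, and [f = h + g]; only the contribution of [h] to [y1] is
   integrated by parts. *)
pose h s := f s - p s * x1 s - a * x s.
have ih : loc_integrable0 h.
  move=> T T0; rewrite (_ : _ \o _ = (EFin \o f) \- (EFin \o g))%E.
    by apply: integrableB => //; [exact: hf|exact: ig].
  by apply/funext => s; rewrite /= /h /g -EFinB opprD addrA.
(* The term [- a * x1 s] is what the integration by parts leaves when the derivative falls on the
   kernel. *)
pose q s := g s - a * x1 s.
have iax1 : loc_integrable0 (fun s => a * x1 s).
  move=> T T0; apply: (integrable_continuousM _ _ _ _ _ _ (ix1 T T0)).
  exact/continuous_subspaceT/cst_continuous.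
have iq : loc_integrable0 q.
  move=> T T0; rewrite (_ : _ \o _ =
    (EFin \o g) \- (EFin \o (fun s => a * x1 s)%R))%E//.
  by apply: integrableB => //; [exact: ig|exact: iax1].
have y1E t : 0 <= t -> y1 w f t = x1 t +
    Rintegral (@lebesgue_measure R) `[0, t] (fun s => expR (- a * (t - s)) * q s).
  move=> t0.
  have iE u : loc_integrable0 u -> (@lebesgue_measure R).-integrable `[0, t]
      (EFin \o (fun s => expR (- a * (t - s)) * u s)).
    by move=> iu; apply: integrable_exp_kernelM; exact: iu.
  transitivity (Rintegral (@lebesgue_measure R) `[0, t]
      (fun s => expR (- a * (t - s)) * h s + expR (- a * (t - s)) * g s)).
    by apply: eq_Rintegral => s _; rewrite /h /g; ring.
  rewrite RintegralD//; [|exact: iE|exact: iE].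
  rewrite Rintegral_exp_kernel_by_parts; last exact: ih.
  (* As x'(0) = 0, [x1] is exactly the primitive of [h] vanishing at 0. The same fact is used below
     under the integral sign. *)
  have -> : Rintegral (@lebesgue_measure R) `[0, t] h = x1 t.
    by rewrite x1E// hx10 add0r.
  transitivity (x1 t - Rintegral (@lebesgue_measure R) `[0, t]
      (fun s => expR (- a * (t - s)) * (a * x1 s)) +
    Rintegral (@lebesgue_measure R) `[0, t] (fun s => expR (- a * (t - s)) * g s)).
    congr (_ - _ + _); apply: eq_Rintegral => s; rewrite inE/= in_itv/=.
    move=> /andP[s0 _]; rewrite (x1E s s0) hx10 add0r -/h; ring.
  rewrite -addrA; congr (_ + _); rewrite addrC -RintegralB//; [|exact: iE|exact: iE].
  by apply: eq_Rintegral => s _; rewrite /q; ring.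
have q0 : q t @[t --> +oo] --> 0.
  rewrite -(subr0 0) -[X in _ --> _ - X](mulr0 a); apply: cvgB; last first.
    by apply: cvgM => //; exact: cvg_cst.
  rewrite -(addr0 0) -[X in _ --> _ + X](mulr0 a); apply: cvgD; last first.
    by apply: cvgM => //; exact: cvg_cst.
  (* The remaining term [p t * x1 t] is squeezed, using [p t <= p 0], between 0 and [p 0] times the
     norm of [x1 t]. *)
  apply/norm_cvg0P.
  have bnd : \forall t \near +oo, 0 <= `|p t * x1 t| <= p 0 * `|x1 t|.
    near=> t.
    have t0 : 0 <= t by near: t; apply: nbhs_pinfty_ge; rewrite num_real.
    rewrite normr_ge0 normrM gtr0_norm ?hpos//=.
    by rewrite ler_wpM2r// ple.
  apply: (squeeze_cvgr bnd); first exact: cvg_cst.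
  rewrite -[X in _ --> X](mulr0 (p 0)); apply: cvgM; first exact: cvg_cst.
  exact/norm_cvg0P.
have lim : x1 t + Rintegral (@lebesgue_measure R) `[0, t]
    (fun s => expR (- a * (t - s)) * q s) @[t --> +oo] --> 0.
  rewrite -[X in _ --> X](addr0 0).
  have conv := cvg_exp_convolution0 _ _ _ a0 iq q0.
  exact: (cvgD hx1lim conv).
(* The formula for [y1] is available for [0 <= t] only, which suffices for a limit at infinity. *)
apply: cvg_trans lim; apply: near_eq_cvg; near=> t.
have t0 : 0 <= t by near: t; apply: nbhs_pinfty_ge; rewrite num_real.
by rewrite y1E.
Unshelve. all: by end_near.
Qed.
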